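(* Let $n$ be a positive integer with $n\equiv 0\pmod{12}$, and let $C$ be a Type III code of length $n$ containing the all-ones vector $\mathbf 1$. Then for every integer $k$ with $0<k\le\frac n2$, the number $L_k^{\mathrm{III}}(n,\mathbf 1)$ of Type III codes of length $n$ that contain $\mathbf 1$ and are $k$-neighbors of $C$ is $$L_k^{\mathrm{III}}(n,\mathbf 1)=\frac{\prod_{i=0}^{k-1}\left(3^{\,n-2-i}-3^{\frac n2-1}\right)}{\prod_{j=0}^{k-1}\left(3^{\frac n2}-3^{\frac n2-1-j}\right)}.$$
   Context: Equip $\mathbb{F}_3^n$ with the inner product $u\cdot v=\sum_{i=1}^n u_iv_i$. A code of length $n$ over $\mathbb{F}_3$ is a linear subspace $C\subseteq\mathbb{F}_3^n$; its dual is $C^\perp=\{v\in\mathbb{F}_3^n : u\cdot v=0 \text{ for all } u\in C\}$, and $C$ is self-dual if $C=C^\perp$ (so $\dim C=n/2$). The weight of a vector is its number of nonzero coordinates. A Type III code is a self-dual code over $\mathbb{F}_3$ in which every codeword has weight divisible by $3$. $\mathbf 1=(1,\dots,1)$. For $0\le k\le n/2$, two self-dual codes $C,D$ of length $n$ are $k$-neighbors if $\dim(C\cap D)=\frac n2-k$. *)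

(* Defs.v *)
From HB Require Import structures.
From mathcomp Require Import all_boot all_order all_algebra.

Set Implicit Arguments.
Unset Strict Implicit.
Unset Printing Implicit Defensive.

Import GRing.Theory VectorInternalTheory.
Local Open Scope ring_scope.

(* A finite vector space has finitely many subspaces: {vspace vT} is a subtype
   (through vs2mx) of a type of matrices over the finite base field. *)
HB.instance Definition _ (K : finFieldType) (vT : vectType K) :=
  [Countable of {vspace vT} by <:].
HB.instance Definition _ (K : finFieldType) (vT : vectType K) :=
  [Finite of {vspace vT} by <:].

Definition code (n : nat) := {vspace 'rV['F_3]_n}.

HB.instance Definition _ (n : nat) := Finite.on (code n).

Definition dotv (n : nat) (u v : 'rV['F_3]_n) : 'F_3 :=
  \sum_(i < n) u ord0 i * v ord0 i.

Definition dual (n : nat) (C : code n) : {set 'rV['F_3]_n} :=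
  [set v | [forall u in C, dotv u v == 0]].

Definition self_dual (n : nat) (C : code n) : bool :=
  [set v in C] == dual C.

Definition weight (n : nat) (v : 'rV['F_3]_n) : nat :=
  #|[set i : 'I_n | v ord0 i != 0]|.

Definition type_III (n : nat) (C : code n) : bool :=
  self_dual C && [forall v in C, (3 %| weight v)%N].

Definition all_ones (n : nat) : 'rV['F_3]_n := const_mx 1.

Definition k_neighbors (n k : nat) (C D : code n) : bool :=
  [&& (k <= n./2)%N, self_dual C, self_dual D
    & \dim (C :&: D)%VS == (n./2 - k)%N].

Definition L_III (n k : nat) (C : code n) : nat :=
  #|[set D : code n | [&& type_III D, all_ones n \in D & k_neighbors k C D]]|.

(* Main.v *)
Require Import Defs.
From mathcomp Require Import all_boot all_order all_algebra all_field.
From mathcomp Require Import ring zify.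

Set Implicit Arguments.
Unset Strict Implicit.
Unset Printing Implicit Defensive.

Import GRing.Theory Num.Theory.
Local Open Scope ring_scope.

(** Write N = n / 2. A self-dual ternary code is automatically of Type III,
    because u.u is the weight of u modulo 3. So the codes to count are the
    self-dual codes D containing the all-ones vector 1 with
    dim (D :&: C) = N - k; call this set the k-th layer around C.

    Two consecutive layers are compared by counting the pairs (D, D') of
    1-neighbors with D in layer k and D' in layer k + 1, from both ends. The
    tool is a parametrization of the 1-neighbors of a self-dual D by vectors
    outside D: for w not in D there is exactly one 1-neighbor D' of D with
    w in D + D' ([nbr_exists], [nbr_unique]). It meets D in the hyperplane
    D :&: perp <[w]> ([nbr_capl]), and D' is the second isotropic point of the
    hyperbolic line (D + D') / (D :&: D'). Each D' arises from the
    3^(N+1) - 3^N vectors w of (D + D') \ D, so counting 1-neighbors amounts to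
    counting vectors ([nbr_degree]).

    Which w lead to which layer? D' contains 1 iff w is orthogonal to 1. The
    dimension of the intersection with C always changes by exactly one: it
    grows if w is orthogonal to E = D :&: C and drops otherwise
    ([dim_nbr_cap], [nbr_sub_perp]). Hence a code of layer k has upward
    neighbors for the 3^(n-1) - 3^(N+k) vectors w in perp <[1]> \ perp E, and a
    code of layer k + 1 has downward neighbors for the 3^(N+k+1) - 3^N vectors
    w in perp E \ D. Summing over a layer gives

      L_k (3^(n-1) - 3^(N+k)) = L_(k+1) (3^(N+k+1) - 3^N)

    ([layer_double_count]). As L_0 = 1, and consecutive values of the claimed
    product satisfy the same relation, the formula follows by induction. *)

(** * The dot product and orthogonal codes *)

Section NeighborCount.
Variable n : nat.
Implicit Types (u v w : 'rV['F_3]_n) (U V W C D : code n).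

Lemma dotvC u v : dotv u v = dotv v u.
Proof. by apply: eq_bigr => i _; rewrite mulrC. Qed.

Lemma dotvDr u v w : dotv u (v + w) = dotv u v + dotv u w.
Proof. by rewrite -big_split; apply: eq_bigr => i _; rewrite mxE mulrDr. Qed.

Lemma dotvZr a u v : dotv u (a *: v) = a * dotv u v.
Proof. by rewrite big_distrr; apply: eq_bigr => i _; rewrite mxE mulrCA. Qed.

Lemma dotvDl u v w : dotv (u + v) w = dotv u w + dotv v w.
Proof. by rewrite !(dotvC _ w) dotvDr. Qed.

Lemma dotvZl a u v : dotv (a *: u) v = a * dotv u v.
Proof. by rewrite !(dotvC _ v) dotvZr. Qed.

Lemma dotv0r u : dotv u 0 = 0.
Proof. by rewrite -(scale0r 0) dotvZr mul0r. Qed.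

Lemma dotv_sumr I (r : seq I) (P : pred I) u (F : I -> 'rV['F_3]_n) :
  dotv u (\sum_(i <- r | P i) F i) = \sum_(i <- r | P i) dotv u (F i).
Proof. exact: (big_morph _ (dotvDr u) (dotv0r u)). Qed.

(** Every nonzero element of F_3 has square 1. *)
Lemma dotv_weight v : dotv v v = (weight v)%:R.
Proof.
rewrite /weight -sum1_card natr_sum [RHS]big_mkcond; apply: eq_bigr => i _.
by rewrite inE; case: (v ord0 i) => [[|[|[|]]]] //= ?; apply/val_inj.
Qed.

(** Its kernel is the orthogonal of [U]. Recording the products with a basis of
    [U], rather than with all of [U], makes it surjective, so that the dimension
    of the kernel is a matter of rank. *)
Definition pairing U : 'Hom('rV['F_3]_n, 'rV['F_3]_(\dim U)) :=
  linfun (mulmxr (\matrix_(i < \dim U) (vbasis U)`_i)^T).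

Fact perp_key : unit. Proof. by []. Qed.
(** The lock keeps unification from unfolding kernels into Gaussian
    elimination when it compares two orthogonals. *)
Definition perp : code n -> code n :=
  locked_with perp_key (fun U => lker (pairing U)).

Arguments perp U%_VS.

Lemma perpE U : perp U = lker (pairing U).
Proof. by rewrite /perp locked_withE. Qed.

Lemma pairingE U w i : pairing U w 0 i = dotv (vbasis U)`_i w.
Proof.
rewrite lfunE /= mxE; apply: eq_bigr => j _.
by rewrite !mxE mulrC; congr (_ * _).
Qed.

Lemma perpP U w : reflect {in U, forall u, dotv u w = 0} (w \in perp U).
Proof.
rewrite perpE memv_ker; apply: (iffP eqP) => [w0 u /coord_vbasis -> | w0].
  rewrite dotvC dotv_sumr big1 // => i _.
  by rewrite dotvZr dotvC -pairingE w0 mxE mulr0.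
apply/rowP => i; rewrite pairingE mxE w0 // vbasis_mem // mem_nth //.
by rewrite size_tuple.
Qed.

(** The dot product is nondegenerate: a basis of [U] is a row-free matrix, so
    [pairing U] is onto. *)
Lemma dim_perp U : (\dim (perp U) + \dim U = n)%N.
Proof.
set B := \matrix_(i < \dim U) (vbasis U)`_i.
have Bfree : row_free B.
  rewrite -kermx_eq0; apply/rowV0P => c /sub_kermxP cB.
  apply/rowP => i; rewrite mxE.
  apply: (elimT freeP (basis_free (vbasisP U)) (fun i => c 0 i)).
  by rewrite -[RHS]cB mulmx_sum_row; apply: eq_bigr => j _; rewrite rowK.
have Bfull : limg (pairing U) = fullv.
  apply/eqP; rewrite eqEsubv subvf; apply/subvP => y _.
  apply/memv_imgP; exists (y *m pinvmx B^T); rewrite ?memvf //.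
  rewrite lfunE /= mulmxKpV // submx_full //.
  by rewrite /row_full mxrank_tr.
have := limg_ker_dim (pairing U) fullv.
by rewrite perpE capfv Bfull !dimvf /dim /= !mul1n.
Qed.

Lemma perpS U V : (U <= V)%VS -> (perp V <= perp U)%VS.
Proof.
move=> /subvP sUV; apply/subvP => w /perpP wV.
by apply/perpP => u /sUV; exact: wV.
Qed.

Lemma perpD U V : perp (U + V) = (perp U :&: perp V)%VS.
Proof.
apply/eqP; rewrite eqEsubv subv_cap !perpS ?addvSl ?addvSr //=.
apply/subvP => w /memv_capP[/perpP wU /perpP wV].
apply/perpP => _ /memv_addP[u uU [v vV ->]].
by rewrite dotvDl wU // wV // addr0.
Qed.

Lemma mem_perp_line u w : (w \in perp <[u]>) = (dotv u w == 0).
Proof.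
apply/perpP/eqP => [-> // | uw0 _ /vlineP[a ->]]; first exact: memv_line.
by rewrite dotvZl uw0 mulr0.
Qed.

Lemma mem_perp_sub U w : (w \in perp U) = (U <= perp <[w]>)%VS.
Proof.
apply/perpP/subvP => wU u uU; first by rewrite mem_perp_line dotvC wU.
by apply/eqP; rewrite dotvC -mem_perp_line wU.
Qed.

Lemma dim_addv_line U w : w \notin U -> \dim (U + <[w]>) = (\dim U).+1.
Proof.
move=> wU; rewrite dimv_disjoint_sum ?dim_vline.
  by rewrite (contraNneq _ wU) ?addn1 // => ->; apply: mem0v.
apply/eqP; rewrite -subv0; apply/subvP => x /memv_capP[+ /vlineP[a def_x]].
rewrite def_x; have [-> | a0] := eqVneq a 0; first by rewrite scale0r memv0.
by move/(rpredZ a^-1); rewrite scalerK // (negPf wU).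
Qed.

Lemma dotv_sqD u v : dotv (u + v) (u + v) = dotv u u + dotv u v *+ 2 + dotv v v.
Proof. rewrite dotvDl !dotvDr (dotvC v u); ring. Qed.

(** * Self-dual codes *)

Lemma self_dualP D : reflect (perp D = D) (self_dual D).
Proof.
apply: (iffP eqP) => [/setP eqD | eqD].
  apply/vspaceP => v; have := eqD v; rewrite !inE => ->.
  by apply/perpP/forall_inP => vD u /vD => [-> | /eqP].
apply/setP => v; rewrite !inE -[in LHS]eqD.
by apply/perpP/forall_inP => vD u /vD => [-> | /eqP].
Qed.

(** The weight of [v] is [dotv v v] modulo 3, which vanishes on a self-dual
    code. *)
Lemma type_IIIE D : type_III D = self_dual D.
Proof.
apply/andb_idr => /self_dualP eqD; apply/forall_inP => v vD.
have := vD; rewrite -{1}eqD => /perpP/(_ v vD)/eqP.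
by rewrite dotv_weight -(dvdn_pcharf (pchar_Fp _)).
Qed.

Lemma dim_self_dual D : self_dual D -> \dim D = n./2.
Proof. by move/self_dualP => eqD; have := dim_perp D; rewrite eqD; lia. Qed.

Lemma dotv_self_dual D u v : self_dual D -> u \in D -> v \in D -> dotv u v = 0.
Proof. by move/self_dualP => eqD uD; rewrite -{1}eqD => /perpP/(_ u uD). Qed.

Lemma mem_self_dual D v :
  self_dual D -> {in D, forall u, dotv u v = 0} -> v \in D.
Proof. by move/self_dualP => eqD Dv; rewrite -eqD; apply/perpP. Qed.

(** * Neighbors of codimension one *)

Lemma k_neighbors_sym k C D : k_neighbors k C D = k_neighbors k D C.
Proof. by rewrite /k_neighbors capvC; congr (_ && _); rewrite andbCA. Qed.

Definition nbr D D' := k_neighbors 1 D D'.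

Lemma nbrP D D' :
  reflect [/\ self_dual D, self_dual D' & (\dim (D :&: D')).+1 = n./2]
    (nbr D D').
Proof.
rewrite /nbr /k_neighbors; apply: (iffP and4P) => [[n0 -> -> /eqP]|[-> -> <-]].
  by split=> //; lia.
by rewrite subn1.
Qed.

Lemma nbr_sym D D' : nbr D D' = nbr D' D.
Proof. exact: k_neighbors_sym. Qed.

Lemma nbr_line D D' x : nbr D D' -> x \in D' -> x \notin D ->
  (D :&: D' + <[x]>)%VS = D'.
Proof.
move=> /nbrP[sD sD' dimH] xD' xD; apply/eqP; rewrite eqEdim.
rewrite subv_add capvSr -memvE xD' (dim_self_dual sD') -dimH /=.
rewrite ltnNge; apply: contra xD => le.
have /eqP eqH : (D :&: D' == D :&: D' + <[x]>)%VS by rewrite eqEdim addvSl.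
by have := subvP (addvSr (D :&: D') _) x (memv_line x); rewrite -eqH => /memv_capP[].
Qed.

(** [D] and [D'] both lie in the orthogonal of [D :&: D'], and the dimensions
    agree. *)
Lemma nbr_add_perp D D' : nbr D D' -> (D + D')%VS = perp (D :&: D').
Proof.
move=> /nbrP[sD sD' dimH]; apply/eqP; rewrite eqEdim subv_add.
have /self_dualP eqD := sD; have /self_dualP eqD' := sD'.
have := perpS (capvSl D D'); have := perpS (capvSr D D').
rewrite eqD eqD' => -> -> /=.
have := dimv_sum_cap D D'; have := dim_perp (D :&: D')%VS; have := dim_perp D.
rewrite eqD (dim_self_dual sD) (dim_self_dual sD'); lia.
Qed.

(** The quotient of [D + D'] by [D :&: D'] is a hyperbolic plane, whose only
    isotropic lines are the images of [D] and [D']: if [x = d + d'] is isotropic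
    then [dotv d d' = 0] since 2 is invertible, so [d] is orthogonal to all of
    [D'] once [d'] lies outside [D]. *)
Lemma nbr_isotropic D D' x : nbr D D' -> x \in (D + D')%VS -> dotv x x = 0 ->
  (x \in D) || (x \in D').
Proof.
move=> nDD' /memv_addP[d dD [d' d'D' ->]] /eqP.
have /nbrP[sD sD' _] := nDD'.
rewrite dotv_sqD (dotv_self_dual sD dD dD) (dotv_self_dual sD' d'D' d'D').
rewrite add0r addr0 -mulr_natr mulf_eq0 orbF => /eqP dd'0.
have [d'D | d'D] := boolP (d' \in D); first by rewrite rpredD.
suff dD' : d \in D' by rewrite orbC rpredD.
apply: mem_self_dual => // u; rewrite -(nbr_line nDD' d'D' d'D).
move=> /memv_addP[v /memv_capP[vD _] [_ /vlineP[a ->] ->]].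
by rewrite dotvDl dotvZl (dotvC d') dd'0 (dotv_self_dual sD vD dD) mulr0 addr0.
Qed.

(** [w] is orthogonal to [D :&: D'] because it lies in [D + D'], and
    [D :&: perp <[w]>] is only a hyperplane of [D] because [w] is outside [D]. *)
Lemma nbr_capl D D' w : nbr D D' -> w \in (D + D')%VS -> w \notin D ->
  (D :&: D' = D :&: perp <[w]>)%VS.
Proof.
move=> nDD' wDD' wD; have /nbrP[sD _ dimH] := nDD'.
have sub : (D :&: D' <= D :&: perp <[w]>)%VS.
  by rewrite subv_cap capvSl -mem_perp_sub -nbr_add_perp.
apply/eqP; rewrite eqEdim sub -ltnS dimH -(dim_self_dual sD).
rewrite ltn_neqAle dimvS ?capvSl // andbT; apply: contra wD => /eqP dimD.
have /eqP/capv_idPl : (D :&: perp <[w]> == D)%VS by rewrite eqEdim capvSl dimD /=.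
by rewrite -mem_perp_sub (self_dualP _ sD).
Qed.

(** [D :&: D'] consists of the vectors of [D] orthogonal to [w]. *)
Lemma nbr_sub_perp D D' w U : nbr D D' -> w \in (D + D')%VS -> w \notin D ->
  (U <= D)%VS -> (U <= D')%VS = (w \in perp U).
Proof.
move=> nDD' wDD' wD sUD; rewrite [RHS]mem_perp_sub.
by rewrite -[LHS]andTb -sUD -subv_cap (nbr_capl nDD' wDD' wD) subv_cap sUD.
Qed.

(** Replacing [w] by an isotropic vector [w'] of [w + D], the neighbor is spanned
    by [w'] and the hyperplane of [D] orthogonal to [w]. *)
Lemma nbr_exists D w : self_dual D -> w \notin D ->
  exists2 D', nbr D D' & w \in (D + D')%VS.
Proof.
move=> sD wD; have /self_dualP eqD := sD.
have [d0 d0D d0w] : exists2 d0, d0 \in D & dotv d0 w != 0.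
  apply/exists_inP; apply: contraR wD => /exists_inPn d0w.
  by apply: mem_self_dual => // u /d0w; rewrite negbK => /eqP.
(* On the line w + F d0 the square is w.w + 2 a (w.d0), affine in a; as
   -1/2 = 1 in F_3, it vanishes at a = w.w / w.d0. *)
pose w' := w + (dotv w w / dotv d0 w) *: d0.
have w'w' : dotv w' w' = 0.
  rewrite dotv_sqD dotvZr dotvZl dotvZr (dotvC w d0) (dotv_self_dual sD d0D d0D).
  rewrite divfK // !mulr0 addr0 -mulrS -mulr_natr.
  by rewrite (_ : 3%:R = 0) ?mulr0 //; apply/val_inj.
have w'D : w' \notin D.
  by apply: contra wD => /rpredB/(_ (rpredZ (dotv w w / dotv d0 w) d0D)); rewrite addrK.
pose H := (D :&: perp <[w]>)%VS.
have HD u : u \in H -> dotv u w' = 0.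
  move=> /memv_capP[uD]; rewrite mem_perp_line dotvC => /eqP uw.
  by rewrite dotvDr dotvZr uw (dotv_self_dual sD uD d0D) mulr0 addr0.
have dimH : (\dim H).+1 = \dim D.
  have := dim_perp (D + <[w]>)%VS; have := dim_perp D.
  by rewrite perpD eqD dim_addv_line // -/H; lia.
pose D' := (H + <[w']>)%VS.
have dimD' : \dim D' = \dim D.
  by rewrite dim_addv_line //; apply: contra w'D => /memv_capP[].
have sD' : self_dual D'.
  apply/self_dualP/esym/eqP; rewrite eqEdim; apply/andP; split; last first.
    by have := dim_perp D; have := dim_perp D'; rewrite eqD; lia.
  apply/subvP => _ /memv_addP[u uH [_ /vlineP[a ->] ->]].
  apply/perpP => _ /memv_addP[v vH [_ /vlineP[b ->] ->]].
  rewrite dotvDr !dotvDl !(dotvZl, dotvZr) w'w' (dotvC w') !HD //.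
  have /memv_capP[uD _] := uH; have /memv_capP[vD _] := vH.
  by rewrite (dotv_self_dual sD vD uD) !mulr0 !addr0.
have w'D' : w' \in D' by apply: subvP (addvSr _ _) _ (memv_line _).
exists D'; last first.
  have tD := rpredZ (dotv w w / dotv d0 w) d0D.
  have -> : w = - ((dotv w w / dotv d0 w) *: d0) + w' by rewrite addrC addrK.
  by rewrite memv_add ?rpredN.
have dimle : (\dim H <= \dim (D :&: D'))%N.
  by rewrite dimvS // subv_cap capvSl addvSl.
apply/nbrP; split=> //; rewrite -(dim_self_dual sD).
have : ~~ (D' <= D)%VS by apply: contra w'D => /subvP/(_ _ w'D').
have := dimvS (capvSl D D').
have := dimv_leqif_sup (capvSr D D'); rewrite subv_cap subvv andbT => -[_ <-].
by rewrite dimD'; lia.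
Qed.

(** Both neighbors meet [D] in the hyperplane orthogonal to [w], hence span the
    same code with [D]; the vectors of [D1] outside [D] are isotropic in
    [D + D2], and so lie in [D2]. *)
Lemma nbr_unique D D1 D2 w : nbr D D1 -> nbr D D2 -> w \notin D ->
  w \in (D + D1)%VS -> w \in (D + D2)%VS -> D1 = D2.
Proof.
move=> n1 n2 wD w1 w2; have /nbrP[_ s1 _] := n1; have /nbrP[_ s2 _] := n2.
have eqH : (D :&: D1 = D :&: D2)%VS by rewrite (nbr_capl n1 w1) ?(nbr_capl n2 w2).
apply/eqP; rewrite eqEdim (dim_self_dual s1) (dim_self_dual s2) leqnn andbT.
apply/subvP => x x1; have : x \in (D + D2)%VS.
  by rewrite (nbr_add_perp n2) -eqH -(nbr_add_perp n1) (subvP (addvSr _ _)).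
move/(nbr_isotropic n2)/(_ (dotv_self_dual s1 x1 x1))/orP => [xD | //].
have : x \in (D :&: D1)%VS by rewrite memv_cap xD.
by rewrite eqH => /memv_capP[].
Qed.

(** Intersect the hyperbolic plane spanned by [D] and [D'] with [C]: the code
    [M = (D + D') :&: C] has one dimension more than [H = D :&: D' :&: C], and all
    its vectors are isotropic, so it is covered by [D] and [D']. A space covered
    by two subspaces equals one of them, hence one of [D :&: C], [D' :&: C] is
    [M] and the other is [H]. *)
Lemma dim_nbr_cap D D' C : nbr D D' -> self_dual C ->
  if (D :&: C <= D')%VS then \dim (D' :&: C) = (\dim (D :&: C)).+1
  else (\dim (D' :&: C)).+1 = \dim (D :&: C).
Proof.
move=> nDD' sC; have /nbrP[sD sD' dimH] := nDD'.
pose M := ((D + D') :&: C)%VS.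
pose H := (D :&: D' :&: C)%VS.
have dimM : \dim M = (\dim H).+1.
  (* M is the orthogonal of (D :&: D') + C. *)
  have := dim_perp (D :&: D' + C)%VS; rewrite perpD (self_dualP _ sC).
  rewrite -nbr_add_perp // -/M.
  have := dimv_sum_cap (D :&: D') C; have := dim_perp C.
  rewrite (self_dualP _ sC) (dim_self_dual sC) -/H; lia.
have Mcase x : x \in M -> (x \in D) || (x \in D').
  move=> /memv_capP[xDD' inC].
  by apply: nbr_isotropic; last exact: (dotv_self_dual sC inC inC).
have sHD : (H <= D :&: C)%VS by rewrite capvS ?capvSl.
have sHD' : (H <= D' :&: C)%VS by rewrite capvS ?capvSr.
have sDM : (D :&: C <= M)%VS by rewrite capvS ?addvSl.
have sD'M : (D' :&: C <= M)%VS by rewrite capvS ?addvSr.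
have := dimvS sHD; have := dimvS sDM; have := dimvS sD'M.
have [sE | nsE] := boolP (D :&: C <= D')%VS.
  have eqH : (D :&: C)%VS = H.
    by apply/eqP; rewrite eqEsubv sHD andbT !subv_cap sE capvSl capvSr.
  rewrite eqH dimM; suff -> : (D' :&: C)%VS = M by [].
  apply/eqP; rewrite eqEsubv sD'M /=.
  apply/subvP => x xM; have /memv_capP[_ inC] := xM.
  rewrite memv_cap inC andbT; case/orP: (Mcase x xM) => // xD.
  by apply: (subvP sE); rewrite memv_cap xD.
have /subvPn[e eE eD'] := nsE.
have eqH : (D' :&: C)%VS = H.
  apply/eqP; rewrite eqEsubv sHD' andbT !subv_cap capvSl capvSr !andbT.
  apply/subvP => y yE'; have /memv_capP[yD' _] := yE'.
  have /memv_capP[eD _] := eE.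
  (* As e is outside D', the vector e + y of M can only lie in D. *)
  have := Mcase _ (rpredD (subvP sDM _ eE) (subvP sD'M _ yE')).
  by rewrite rpredDl // [e + y]addrC rpredDl // (negPf eD') orbF.
have [_ dim_eq] := dimv_leqif_sup sHD.
have dim_neq : \dim H != \dim (D :&: C).
  rewrite dim_eq; apply: contra nsE => /subv_trans; apply.
  exact: subv_trans (capvSl _ _) (capvSr _ _).
have dimE' : \dim (D' :&: C) = \dim H by exact: congr1 eqH.
move: dim_neq; clear -dimE' dimM; clearbody M H; lia.
Qed.

(** * Counting neighbors *)

Lemma card_subv U V : (U <= V)%VS ->
  #|[set w in V | w \notin U]| = (3 ^ \dim V - 3 ^ \dim U)%N.
Proof.
have cardE W : #|[set w in W]| = (3 ^ \dim W)%N by rewrite cardsE card_vspace card_Fp.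
move=> sUV; rewrite -!cardE -cardsDS.
  by apply: eq_card => w; rewrite !inE andbC.
by apply/subsetP => w; rewrite !inE; apply: subvP.
Qed.

(** Double counting of the pairs [(D', w)] with [w] in [(D + D') \ D]: such a [w]
    determines [D'], and each [D'] has 3^(N+1) - 3^N of them. The last hypothesis
    says that [W] detects, through [w], the neighbors satisfying [P]. *)
Lemma nbr_degree D (P : pred (code n)) (W : {set 'rV['F_3]_n}) : self_dual D ->
  {in W, forall w, w \notin D} ->
  (forall D' w, nbr D D' -> w \in (D + D')%VS -> w \notin D -> P D' = (w \in W)) ->
  (#|[set D' | nbr D D' & P D']| * (3 ^ (n./2).+1 - 3 ^ n./2) = #|W|)%N.
Proof.
move=> sD WD PW; rewrite -sum_nat_const.
transitivity (\sum_(D' in [set D' | nbr D D' & P D'])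
    \sum_(w in [set w in (D + D')%VS | w \notin D]) 1)%N.
  apply: eq_bigr => D'; rewrite inE sum1_card => /andP[nDD' _].
  have /nbrP[_ sD' dimH] := nDD'.
  rewrite card_subv ?addvSl // (dim_self_dual sD); congr (3 ^ _ - _)%N.
  have := dimv_sum_cap D D'.
  by rewrite (dim_self_dual sD) (dim_self_dual sD'); lia.
rewrite (exchange_big_dep (mem W)) /=; last first.
  move=> D' w; rewrite !inE => /andP[nDD' PD'] /andP[wDD' wD].
  by rewrite -(PW D').
rewrite -sum1_card; apply: eq_bigr => w wW; have wD := WD w wW.
have [D0 nDD0 wD0] := nbr_exists sD wD.
rewrite (big_pred1 D0) // => D'; rewrite !inE wD andbT.
apply/idP/eqP => [/andP[/andP[nDD' _] wD'] | ->].
  exact: (nbr_unique nDD' nDD0 wD).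
by rewrite nDD0 wD0 (PW D0 w) // wW.
Qed.

(** * Layers around a code *)

Definition layer C k : {set code n} :=
  [set D | [&& type_III D, all_ones n \in D & k_neighbors k C D]].

Lemma mem_layer C k D : self_dual C -> (k <= n./2)%N ->
  (D \in layer C k) =
  [&& self_dual D, all_ones n \in D & \dim (D :&: C) == (n./2 - k)%N].
Proof.
move=> sC kN; rewrite inE /k_neighbors sC kN capvC type_IIIE /=.
by case: (self_dual D).
Qed.

Lemma dim_ones : (0 < n)%N -> \dim <[all_ones n]> = 1%N.
Proof.
move=> n0; rewrite dim_vline; case: eqP => // /rowP/(_ (Ordinal n0)).
by rewrite !mxE => /eqP; rewrite oner_eq0.
Qed.

Lemma dim_perp_cap C D k : self_dual C -> (k <= n./2)%N ->
  \dim (D :&: C) = (n./2 - k)%N -> \dim (perp (D :&: C)) = (n./2 + k)%N.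
Proof.
move=> sC kN dimE; have := dim_perp (D :&: C)%VS; have := dim_perp C.
by rewrite dimE (self_dualP _ sC) (dim_self_dual sC); lia.
Qed.

(** From layer [k], the vectors leading to layer [k + 1] are those orthogonal to
    the all-ones vector but not to [D :&: C]. *)
Lemma layer_up C k D : self_dual C -> all_ones n \in C -> (k < n./2)%N ->
  D \in layer C k ->
  (#|[set D' | nbr D D' & D' \in layer C k.+1]| * (3 ^ (n./2).+1 - 3 ^ n./2)
    = 3 ^ n.-1 - 3 ^ (n./2 + k))%N.
Proof.
move=> sC oC kN; rewrite mem_layer ?(ltnW kN) // => /and3P[sD oD /eqP dimE].
have oE : (<[all_ones n]> <= D :&: C)%VS by rewrite subv_cap -!memvE oD.
rewrite (@nbr_degree D _ [set w in perp <[all_ones n]> | w \notin perp (D :&: C)]) //.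
- rewrite card_subv ?perpS // (dim_perp_cap sC _ dimE) ?(ltnW kN) //.
  congr (3 ^ _ - 3 ^ _)%N.
  by have := dim_perp <[all_ones n]>%VS; rewrite dim_ones; lia.
- move=> w; rewrite inE => /andP[_]; apply: contra => wD.
  by rewrite (subvP (perpS (capvSl D C))) // (self_dualP _ sD).
move=> D' w nDD' wDD' wD; have /nbrP[_ sD' _] := nDD'.
rewrite mem_layer // sD' inE memvE (nbr_sub_perp nDD' wDD' wD) -?memvE //=; congr (_ && _).
rewrite -(nbr_sub_perp nDD' wDD' wD (capvSl D C)).
have := dim_nbr_cap nDD' sC; rewrite dimE.
move: (\dim (D' :&: C)) => d; case: ifP => _; move: kN; clear; lia.
Qed.

(** From layer [k + 1], the vectors leading back to layer [k] are those outside
    [D] orthogonal to [D :&: C]; they are orthogonal to the all-ones vector, which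
    lies in [D :&: C]. *)
Lemma layer_down C k D : self_dual C -> all_ones n \in C -> (k < n./2)%N ->
  D \in layer C k.+1 ->
  (#|[set D' | nbr D D' & D' \in layer C k]| * (3 ^ (n./2).+1 - 3 ^ n./2)
    = 3 ^ (n./2 + k.+1) - 3 ^ n./2)%N.
Proof.
move=> sC oC kN; rewrite mem_layer // => /and3P[sD oD /eqP dimE].
have oE : (<[all_ones n]> <= D :&: C)%VS by rewrite subv_cap -!memvE oD.
have sDE : (D <= perp (D :&: C))%VS.
  by rewrite -{1}(self_dualP _ sD) perpS ?capvSl.
rewrite (@nbr_degree D _ [set w in perp (D :&: C) | w \notin D]) //.
- by rewrite card_subv // (dim_perp_cap sC _ dimE) // (dim_self_dual sD).
- by move=> w; rewrite inE => /andP[].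
move=> D' w nDD' wDD' wD; have /nbrP[_ sD' _] := nDD'.
rewrite mem_layer ?(ltnW kN) // sD' inE wD andbT.
rewrite andTb memvE (nbr_sub_perp nDD' wDD' wD) -?memvE //.
rewrite -(nbr_sub_perp nDD' wDD' wD (capvSl D C)).
have := dim_nbr_cap nDD' sC; rewrite dimE.
move: (\dim (D' :&: C)) => d.
have [sE | nsE] := boolP (D :&: C <= D')%VS; last first.
  by move=> dE; rewrite andbC; case: eqP => // dE'; move: dE dE' kN; clear; lia.
move=> ->; rewrite subnSK // eqxx andbT.
rewrite (nbr_sub_perp nDD' wDD' wD (capvSl D C)) in sE.
by rewrite (subvP (perpS oE)).
Qed.

Lemma layer_double_count C k : self_dual C -> all_ones n \in C -> (k < n./2)%N ->
  (#|layer C k| * (3 ^ n.-1 - 3 ^ (n./2 + k)) =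
   #|layer C k.+1| * (3 ^ (n./2 + k.+1) - 3 ^ n./2))%N.
Proof.
move=> sC oC kN; rewrite -!sum_nat_const.
under eq_bigr => D LD do rewrite -(layer_up sC oC kN LD) -sum_nat_const.
under [RHS]eq_bigr => D LD do rewrite -(layer_down sC oC kN LD) -sum_nat_const.
rewrite (exchange_big_dep (mem (layer C k.+1))) /=; last first.
  by move=> D D' _; rewrite inE => /andP[].
apply: eq_bigr => D' LD'; apply: eq_bigl => D.
by move: LD'; rewrite !inE nbr_sym => ->; rewrite andbT andbC.
Qed.

Lemma card_layer0 C : self_dual C -> all_ones n \in C -> #|layer C 0| = 1%N.
Proof.
move=> sC oC; rewrite -(cards1 C); apply: eq_card => D.
rewrite mem_layer // subn0 inE; apply/and3P/eqP => [[sD _ /eqP dimE] | ->]; last first.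
  by rewrite capvv (dim_self_dual sC).
apply/eqP; rewrite eqEdim (dim_self_dual sC) (dim_self_dual sD) leqnn andbT.
have /eqP : (D :&: C == D)%VS by rewrite eqEdim capvSl dimE (dim_self_dual sD) /=.
by move/capv_idPl.
Qed.

End NeighborCount.

(** * The closed formula *)

Theorem theorem4p12 (n : nat) (hn : (0 < n)%N) (hn12 : n = 0 %[mod 12])
    (C : code n) (hC : type_III C) (h1 : all_ones n \in C)
    (k : nat) (hk0 : (0 < k)%N) (hk : (k <= n./2)%N) :
  (L_III k C)%:R =
    (\prod_(i < k) (3 ^+ (n - 2 - i)%N - 3 ^+ (n./2 - 1)%N)) /
    (\prod_(j < k) (3 ^+ n./2 - 3 ^+ (n./2 - 1 - j)%N)) :> rat.
Proof.
rewrite type_IIIE in hC; rewrite /L_III -/(layer C k).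
have n2 : n = (n./2 + n./2)%N.
  by have := dim_perp C; rewrite (self_dualP _ hC) (dim_self_dual hC) => ->.
elim: k hk {hk0} => [|k IHk] kN; first by rewrite !big_ord0 card_layer0 // divr1.
rewrite !big_ord_recr /= -mulf_div -IHk ?(ltnW kN) //.
(* With a = 3^k and b = 3^m the goal becomes a rational identity in a and b. *)
have [m Nm] : exists m, n./2 = (k + m).+1 by exists (n./2 - k.+1)%N; lia.
have := layer_double_count hC h1 kN => /(congr1 (fun m => m%:R : rat)).
rewrite !natrM !natrB ?leq_exp2l ?natrX; try lia.
rewrite (_ : n.-1 = k + k + m + m + 1)%N; last lia.
rewrite (_ : n./2 + k = k + k + m + 1)%N; last lia.
rewrite (_ : n./2 + k.+1 = k + k + m + 2)%N; last lia.
rewrite (_ : n - 2 - k = k + m + m)%N; last lia.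
rewrite (_ : n./2 - 1 - k = m)%N; last lia.
rewrite (_ : n./2 - 1 = k + m)%N; last lia.
rewrite (_ : n./2 = k + m + 1)%N; last lia.
rewrite !exprD expr1.
have a0 : 3 ^+ k != 0 :> rat by rewrite expf_neq0.
have b0 : 3 ^+ m != 0 :> rat by rewrite expf_neq0.
have c0 : 3 * 3 ^+ k - 1 != 0 :> rat.
  by rewrite subr_eq0 -exprS -natrX pnatr_eq1 -(expn0 3) eqn_exp2l.
move: (3 ^+ k) (3 ^+ m) a0 b0 c0 => a b a0 b0 c0 count.
move: #|layer C k|%:R #|layer C k.+1|%:R count => x y count.
have d0 : a * b * 3 - b != 0.
  by rewrite (_ : _ - b = b * (3 * a - 1)) ?mulf_neq0 //; ring.
apply: (mulIf (mulf_neq0 a0 d0)); apply: (@mulIf _ 3) => //.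
transitivity (y * (a * a * b * 3 ^+ 2 - a * b * 3)); first by ring.
by rewrite -count mulrA; field.
Qed.
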